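(* Let $H=(V,E)$ and $A=(Q,C)$ be finite simple undirected graphs with $|V|=|Q|$, let $T\ge 1$ be an integer, and fix a connection $(p,q)\in C$. Let $P^{\le}_{pq}$ be the convex hull of all vectors $(w^t_{pi},w^t_{qj},y^t_{pqij})\in\{0,1\}^{T(2|V|+|\bar E|)}$ (indices $t\in[T]$, $i\in V$ for $w^t_{pi}$, $j\in V$ for $w^t_{qj}$, $(i,j)\in\bar E$ for $y^t_{pqij}$) satisfying $$\sum_{i\in V}w^t_{pi}=1,\quad \sum_{i\in V}w^t_{qi}=1\quad (t\in[T]),\qquad \sum_{t\in[T]}\sum_{(i,j)\in\bar E}y^t_{pqij}\ge 1,$$ $$y^t_{pqij}\le w^t_{pi},\quad y^t_{pqij}\le w^t_{qj}\qquad ((i,j)\in\bar E,\ t\in[T]).$$ Then $P^{\le}_{pq}$ equals the set of all vectors $(w^t_{pi},w^t_{qj},y^t_{pqij})\in[0,1]^{T(2|V|+|\bar E|)}$ satisfying $$\sum_{i\in V}w^t_{pi}=1,\quad \sum_{i\in V}w^t_{qi}=1\quad (t\in[T]),\qquad \sum_{t\in[T]}\sum_{(i,j)\in\bar E}y^t_{pqij}\ge 1,$$ $$\sum_{j\in N(i)}y^t_{pqij}\le w^t_{pi},\quad \sum_{j\in N(i)}y^t_{pqji}\le w^t_{qi}\qquad (i\in V,\ t\in[T]).$$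
   Context: $[T]=\{1,\dots,T\}$. $\bar E$ is the set of arcs containing both $(i,j)$ and $(j,i)$ for each undirected edge $\{i,j\}\in E$. $N(i)\subseteq V$ is the set of neighbors of $i$ in $H$. Each connection $\{p,q\}\in C$ is represented by an ordered pair $(p,q)$. *)

(* Defs.v *)
From HB Require Import structures.
From mathcomp Require Import all_boot all_order all_algebra.
From mathcomp Require Import classical_sets reals convex.

Set Implicit Arguments.
Unset Strict Implicit.
Unset Printing Implicit Defensive.

Import Order.TTheory GRing.Theory Num.Theory.
Local Open Scope classical_set_scope.
Local Open Scope ring_scope.

Record sgraph (V : finType) := SGraph {
  adj :> rel V;
  adj_sym : symmetric adj;
  adj_irr : irreflexive adj }.

Definition neighbors (V : finType) (H : sgraph V) (i : V) : {set V} :=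
  [set j | H i j]%SET.

(* Both orientations of every edge occur here, by symmetry of adjacency. *)
Definition arcs (V : finType) (H : sgraph V) : {set V * V} :=
  [set a | H a.1 a.2]%SET.

(* The coordinates: for each time t, a coordinate w^t_{ui} for each endpoint
   u in {p, q} and i in V, and a coordinate y^t_{pqij} for each arc (i, j). *)
Definition coord (V Q : finType) (H : sgraph V) (T : nat) (p q : Q) : finType :=
  ('I_T * ({u : Q | u \in [set p; q]%SET} * V + {a : V * V | a \in arcs H}))%type.

Lemma card_coord (V Q : finType) (H : sgraph V) (T : nat) (p q : Q) :
  p != q -> #|coord H T p q| = (T * (2 * #|V| + #|arcs H|))%N.
Proof.
by move=> pq; rewrite card_prod card_ord card_sum card_prod !card_sig cards2 pq.
Qed.

Section Polytopes.
Variables (R : realType) (V Q : finType) (H : sgraph V) (T : nat) (p q : Q).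

Local Notation vec := {ffun coord H T p q -> R^o}.

Definition w_p (x : vec) (t : 'I_T) (i : V) : R :=
  x (t, inl (exist _ p (set21 p q), i)).

Definition w_q (x : vec) (t : 'I_T) (j : V) : R :=
  x (t, inl (exist _ q (set22 p q), j)).

(* The default 0 is never used below: y_pq is only evaluated at pairs (i, j) that
   are arcs of H. *)
Definition y_pq (x : vec) (t : 'I_T) (i j : V) : R :=
  if insub (i, j) is Some a then x (t, inr a) else 0.

Definition one_vertex_each (x : vec) : Prop :=
  forall t, \sum_i w_p x t i = 1 /\ \sum_i w_q x t i = 1.

Definition some_arc (x : vec) : Prop :=
  \sum_t \sum_(a in arcs H) y_pq x t a.1 a.2 >= 1.

Definition binary_points : set vec :=
  [set x : vec | [/\ forall k, x k = 0 \/ x k = 1,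
               one_vertex_each x,
               some_arc x &
               forall t i j, (i, j) \in arcs H ->
                 y_pq x t i j <= w_p x t i /\ y_pq x t i j <= w_q x t j]].

(* The convex hull, as the least convex set containing the points. *)
Definition Ple : set vec := smallest (@convex_set R vec) binary_points.

Definition neighbor_polytope : set vec :=
  [set x : vec | [/\ forall k, 0 <= x k <= 1,
               one_vertex_each x,
               some_arc x &
               forall t i,
                 \sum_(j in neighbors H i) y_pq x t i j <= w_p x t i /\
                 \sum_(j in neighbors H i) y_pq x t j i <= w_q x t i]].

End Polytopes.

Arguments Ple R {V Q} H T p q.
Arguments neighbor_polytope R {V Q} H T p q.

(* Main.v *)
Require Import Defs.
From mathcomp Require Import all_boot all_order all_algebra.
From mathcomp Require Import interval_inference unstable.
From mathcomp Require Import classical_sets reals convex.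
From mathcomp Require Import ring.

(** At a single time, an integral point is a placement: either p and q sit on
    the ends of a chosen arc whose y is 1, or they sit on any two vertices and
    no arc is chosen.  The neighbor inequalities say exactly that a fractional
    point is, at each time, the mean of a probability law on placements: the
    arc a is chosen with probability y_a, and what remains of w_p and w_q after
    the arcs have used their share is coupled independently
    ([neighbor_polytope_blend]).  A point of the neighbor polytope is thus a
    family of laws [mu t], one per time.

    Time steps interact only through the inequality asking that some arc be
    chosen.  It holds in expectation for [mu], and must be made to hold surely
    without changing any of the marginals [mu t].  Let Y_t be the probability
    that an arc is chosen at time t and sigma >= 1 the sum of the Y_t.  Draw a
    time s with probability Y_s / sigma and force the choice of an arc at time
    s.  This uses up the fraction 1 / sigma <= 1 of the arc part of each
    [mu t]; what remains of [mu t], renormalised, is the law at the times t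
    other than s ([blend_expected_arc]).  Once the arc at time s is certain, the
    times can be drawn independently, and the product law writes the point as a
    convex combination of binary points ([blend_sure_arc]).

    Conversely the neighbor polytope is convex and contains the binary points:
    if w_p is 0 at i, all y on arcs leaving i vanish, and if it is 1, their sum
    is at most the total of w_q, which is 1. *)

Set Implicit Arguments.
Unset Strict Implicit.
Unset Printing Implicit Defensive.

Import Order.TTheory GRing.Theory Num.Theory.

(** * Finite convex combinations and product laws *)

Section ConvexCombinations.
Local Open Scope ring_scope.

(** Membership is asked of the points of positive weight only, because
    conditioning on an event of probability zero produces meaningless points.
    The induction is on partial sums renormalised by their weight, as a convex
    set need not contain the partial sums themselves. *)
Lemma convex_set_sum (R : realFieldType) (M : lmodType R)
    (A : set (convex_lmodType M)) (I : finType) (c : I -> R) (x : I -> M) :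
  convex_set A -> (forall i, 0 <= c i) -> \sum_i c i = 1 ->
  (forall i, 0 < c i -> A (x i)) -> A (\sum_i c i *: x i).
Proof.
move=> cvxA c0 c1 Ax.
have normalized (r : seq I) : 0 < \sum_(i <- r) c i ->
    A ((\sum_(i <- r) c i)^-1 *: \sum_(i <- r) c i *: x i).
  elim: r => [|i r IHr]; first by rewrite big_nil ltxx.
  rewrite !big_cons; set C := \sum_(j <- r) c j; set X := \sum_(j <- r) _ => iC.
  have [ci0|ci_neq0] := eqVneq (c i) 0.
    by move: iC; rewrite ci0 scale0r !add0r; exact: IHr.
  have ci_gt0 : 0 < c i by rewrite lt_def ci_neq0 c0.
  have C_ge0 : 0 <= C by apply: sumr_ge0.
  have [C_eq0|C_neq0] := eqVneq C 0.
    have -> : X = 0.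
      rewrite /X big_seq big1 // => j jr.
      move/eqP: C_eq0; rewrite psumr_eq0 // => /allP/(_ j jr)/eqP ->.
      by rewrite scale0r.
    by rewrite C_eq0 !addr0 scalerA mulVf // scale1r; exact: Ax.
  have C_gt0 : 0 < C by rewrite lt_def C_neq0 C_ge0.
  have l0 : 0 <= c i / (c i + C) by rewrite divr_ge0 // ltW.
  have l1 : c i / (c i + C) <= 1 by rewrite ler_pdivrMr // mul1r lerDl.
  have xiA : x i \in A by rewrite inE; exact: Ax.
  have rA : C^-1 *: X \in A by rewrite inE; exact: IHr.
  have := cvxA _ _ (Itv01 l0 l1) xiA rA; rewrite inE.
  congr (A _); rewrite /conv /= /onem scalerDr !scalerA.
  by congr (_ *: _ + _ *: _); field; rewrite gt_eqF // gt_eqF.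
by have := normalized (index_enum I); rewrite c1 invr1 scale1r; apply.
Qed.

(** The marginal at [i0] of a product law.  The factor [g] is absorbed in the
    weight at [i0], and distributivity turns the sum over functions into a
    product of sums, of which only the one at [i0] is not 1. *)
Lemma sum_prod_marginal (R : comPzRingType) (I K : finType) (mu : I -> K -> R)
    (i0 : I) (g : K -> R) :
  (forall i, \sum_k mu i k = 1) ->
  \sum_(f : {ffun I -> K}) (\prod_i mu i (f i)) * g (f i0) =
  \sum_k mu i0 k * g k.
Proof.
move=> mu1; pose nu i k := if i == i0 then mu i k * g k else mu i k.
transitivity (\sum_(f : {ffun I -> K}) \prod_i nu i (f i)).
  apply: eq_bigr => f _; rewrite (bigD1 i0) //= [RHS](bigD1 i0) //= /nu eqxx.
  rewrite mulrAC; congr (_ * _).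
  by apply: eq_bigr => i /negPf ->.
rewrite -bigA_distr_bigA (bigD1 i0) //= /nu eqxx [X in _ * X]big1 ?mulr1 //.
move=> i /negPf ->.
exact: mu1.
Qed.

Lemma convex_set_smallest (R : numDomainType) (M : lmodType R)
    (B : set (convex_lmodType M)) :
  convex_set (smallest (@convex_set R M) B).
Proof.
move=> x y l; rewrite !inE => Bx By A [cvxA BA].
have := cvxA x y l; rewrite !inE; apply; [exact: Bx|exact: By].
Qed.

(** The product coupling of two measures of the same mass [s].  When [s] is 0,
    nonnegativity makes [a] vanish, so the division by zero is harmless. *)
Lemma independent_coupling (R : realFieldType) (I J : finType) (a : I -> R)
    (b : J -> R) (s : R) :
  (forall i, 0 <= a i) -> \sum_i a i = s -> \sum_j b j = s ->
  forall i, \sum_j a i * b j / s = a i.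
Proof.
move=> a0 as_ bs i; rewrite -mulr_suml -mulr_sumr bs.
have [s0|s_neq0] := eqVneq s 0; last by rewrite mulfK.
move/eqP: as_; rewrite s0 psumr_eq0 // => /allP/(_ i).
by rewrite mem_index_enum => /(_ isT)/eqP ->; rewrite !mul0r.
Qed.

End ConvexCombinations.

(** * The neighbor polytope is convex and contains the binary points *)

Section HullOfBinaryPoints.
Local Open Scope ring_scope.

Variables (R : realType) (V Q : finType) (H : sgraph V) (T : nat) (p q : Q).

Local Notation vec := {ffun Defs.coord H T p q -> R^o}.
Local Notation arc := {a : V * V | a \in arcs H}.

Implicit Types (x : vec) (t : 'I_T).

Lemma y_pq_arc x t (a : arc) : y_pq x t (val a).1 (val a).2 = x (t, inr a).
Proof. by rewrite /y_pq -surjective_pairing valK. Qed.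

Lemma sum_arcs x t :
  \sum_(a in arcs H) y_pq x t a.1 a.2 = \sum_(a : arc) x (t, inr a).
Proof.
rewrite (big_sub (arcs H)); apply: eq_bigr => a _; exact: y_pq_arc.
Qed.

Lemma sum_out_arcs x t i :
  \sum_(j in neighbors H i) y_pq x t i j =
  \sum_(a : arc | (val a).1 == i) x (t, inr a).
Proof.
transitivity (\sum_(a in arcs H | a.1 == i) y_pq x t a.1 a.2).
  rewrite [RHS](reindex_onto (fun j => (i, j)) snd) /=; last first.
    by case=> i' j /andP[_ /= /eqP ->].
  by apply: eq_bigl => j; rewrite !inE !eqxx !andbT.
by rewrite (big_sub_cond (arcs H)); apply: eq_bigr => a _; rewrite y_pq_arc.
Qed.

(** By symmetry of adjacency, the arcs entering [i] come from its neighbors. *)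
Lemma sum_in_arcs x t i :
  \sum_(j in neighbors H i) y_pq x t j i =
  \sum_(a : arc | (val a).2 == i) x (t, inr a).
Proof.
transitivity (\sum_(a in arcs H | a.2 == i) y_pq x t a.1 a.2).
  rewrite [RHS](reindex_onto (fun j => (j, i)) fst) /=; last first.
    by case=> i' j /andP[_ /= /eqP ->].
  by apply: eq_bigl => j; rewrite !inE !eqxx !andbT adj_sym.
by rewrite (big_sub_cond (arcs H)); apply: eq_bigr => a _; rewrite y_pq_arc.
Qed.

Lemma binary_points_sub :
  (@binary_points R V Q H T p q `<=` neighbor_polytope R H T p q)%classic.
Proof.
move=> x [bin one arc1 le_yw]; split=> //.
  by move=> k; case: (bin k) => ->; rewrite ?lexx ?ler01.
have wp01 t i : w_p x t i = 0 \/ w_p x t i = 1 by exact: bin.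
have wp_ge0 t i : 0 <= w_p x t i by case: (wp01 t i) => ->.
have wq01 t i : w_q x t i = 0 \/ w_q x t i = 1 by exact: bin.
have wq_ge0 t i : 0 <= w_q x t i by case: (wq01 t i) => ->.
have part (P : pred V) (w : V -> R) : (forall i, 0 <= w i) -> \sum_i w i = 1 ->
    \sum_(i | P i) w i <= 1.
  move=> w0 <-; rewrite [leRHS](bigID P) /= lerDl.
  by apply: sumr_ge0.
move=> t i; have [wp1 wq1] := one t; split.
- have [wi|wi] := wp01 t i.
    rewrite wi; apply: sumr_le0 => j jNi; rewrite -wi.
    have arc_ij : (i, j) \in arcs H by move: jNi; rewrite !inE.
    by have [] := le_yw t _ _ arc_ij.
  rewrite wi; apply: (le_trans _ (part (mem (neighbors H i)) _ (wq_ge0 t) wq1)).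
  apply: ler_sum => j jNi.
  have arc_ij : (i, j) \in arcs H by move: jNi; rewrite !inE.
  by have [] := le_yw t _ _ arc_ij.
- have [wi|wi] := wq01 t i.
    rewrite wi; apply: sumr_le0 => j jNi; rewrite -wi.
    have arc_ij : (j, i) \in arcs H by move: jNi; rewrite !inE adj_sym.
    by have [] := le_yw t _ _ arc_ij.
  rewrite wi; apply: (le_trans _ (part (mem (neighbors H i)) _ (wp_ge0 t) wp1)).
  apply: ler_sum => j jNi.
  have arc_ij : (j, i) \in arcs H by move: jNi; rewrite !inE adj_sym.
  by have [] := le_yw t _ _ arc_ij.
Qed.

Lemma convex_neighbor_polytope :
  @convex_set R vec (neighbor_polytope R H T p q).
Proof.
move=> x y l; rewrite !inE => -[x01 x1 xarc xN] [y01 y1 yarc yN].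
have l0 : 0 <= l%:num by [].
have l1 : 0 <= 1 - l%:num by rewrite subr_ge0.
set z := conv l x y.
have zE k : z k = l%:num * x k + (1 - l%:num) * y k by rewrite /z /conv /= !ffunE.
have sumz (I : finType) (P : pred I) (h : I -> Defs.coord H T p q) :
    \sum_(i | P i) z (h i) =
    l%:num * \sum_(i | P i) x (h i) + (1 - l%:num) * \sum_(i | P i) y (h i).
  by rewrite !mulr_sumr -big_split; apply: eq_bigr => i _; rewrite zE.
have one : l%:num + (1 - l%:num) = 1 :> R by rewrite addrC subrK.
split.
- move=> k; have /andP[xk0 xk1] := x01 k; have /andP[yk0 yk1] := y01 k.
  rewrite zE; apply/andP; split; first by rewrite addr_ge0 // mulr_ge0.
  by rewrite -[leRHS]one lerD // ler_piMr.
- move=> t; have [xp xq] := x1 t; have [yp yq] := y1 t.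
  by rewrite /w_p /w_q !sumz [X in _ * X + _]xp [X in _ + _ * X]yp
    [X in _ /\ (_ * X + _ = _)]xq [X in _ /\ (_ + _ * X = _)]yq !mulr1 one.
- move: xarc yarc; rewrite /some_arc.
  under eq_bigr do rewrite sum_arcs.
  move=> xarc; under eq_bigr do rewrite sum_arcs.
  move=> yarc; under eq_bigr do rewrite sum_arcs.
  under eq_bigr do rewrite sumz.
  rewrite big_split -!mulr_sumr /= -[leLHS]one lerD // ler_peMr //.
- move=> t i; have := yN t i; have := xN t i.
  rewrite !sum_out_arcs !sum_in_arcs /w_p /w_q !sumz !zE.
  by move=> [xp xq] [yp yq]; split; rewrite lerD // ler_wpM2l.
Qed.

(** * Points as means of laws on placements *)

(** [inl a] places p and q on the ends of [a] and chooses [a]; [inr (i, j)]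
    places them on [i] and [j] and chooses no arc, even if [(i, j)] is one. *)
Definition placement : finType := (arc + V * V)%type.

Definition ends (k : placement) : V * V :=
  match k with inl a => val a | inr ij => ij end.

(** The coordinates, at one time, of the integral point given by a placement. *)
Definition placement_coord (k : placement)
    (c : {u : Q | u \in [set p; q]%SET} * V + arc) : R :=
  match c with
  | inl (u, i) => ((if val u == p then (ends k).1 else (ends k).2) == i)%:R
  | inr a => (k == inl a)%:R
  end.

(** The mean of the integral points when the placement at time t has law
    [mu t].  Only the marginals matter, since each coordinate has one time. *)
Definition blend (mu : 'I_T -> placement -> R) : vec :=
  [ffun c => \sum_k mu c.1 k * placement_coord k c.2].

Definition law (m : placement -> R) : Prop :=
  (forall k, 0 <= m k) /\ \sum_k m k = 1.

Lemma sum_indicator (I : finType) (m : I -> R) (P : pred I) :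
  \sum_k m k * (P k)%:R = \sum_(k | P k) m k.
Proof.
by rewrite [RHS]big_mkcond; apply: eq_bigr => k _; case: (P k);
  rewrite ?mulr1 ?mulr0.
Qed.

Lemma w_p_blend mu t i :
  w_p (blend mu) t i = \sum_(k | (ends k).1 == i) mu t k.
Proof. by rewrite /w_p ffunE /= eqxx sum_indicator. Qed.

Lemma w_q_blend mu t i : p != q ->
  w_q (blend mu) t i = \sum_(k | (ends k).2 == i) mu t k.
Proof. by rewrite eq_sym /w_q ffunE /= => /negPf ->; rewrite sum_indicator. Qed.

Lemma y_blend mu t (a : arc) : blend mu (t, inr a) = mu t (inl a).
Proof. by rewrite ffunE /= sum_indicator big_pred1_eq. Qed.

Lemma blend_comb (I : finType) (c : I -> R) (mu : I -> 'I_T -> placement -> R)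
    (nu : 'I_T -> placement -> R) :
  (forall t k, nu t k = \sum_i c i * mu i t k) ->
  blend nu = \sum_i c i *: blend (mu i).
Proof.
move=> nuE; apply/ffunP => -[t d]; rewrite sum_ffunE ffunE /=.
under eq_bigr => k _ do rewrite nuE mulr_suml.
rewrite exchange_big; apply: eq_bigr => i _ /=.
rewrite ffunE ffunE /= [RHS]mulr_sumr; apply: eq_bigr => k _.
by rewrite mulrA.
Qed.

(** The Dirac laws at [f] give the integral point of the schedule [f]; the time
    [s] provides the arc that a binary point must contain. *)
Lemma blend_point_binary (f : 'I_T -> placement) (s : 'I_T) (b : arc) :
  p != q -> f s = inl b ->
  binary_points (blend (fun t k => (k == f t)%:R)).
Proof.
move=> pq fs; set x := blend _.
have point (P : pred placement) t :
    \sum_(k | P k) (k == f t)%:R = (P (f t))%:R :> R.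
  rewrite big_mkcond (bigD1 (f t)) //= eqxx big1 ?addr0; first by case: (P _).
  by move=> k /negPf ->; case: ifP.
have wpE t i : w_p x t i = ((ends (f t)).1 == i)%:R by rewrite w_p_blend point.
have wqE t i : w_q x t i = ((ends (f t)).2 == i)%:R by rewrite w_q_blend // point.
have yE t a : x (t, inr a) = (inl a == f t)%:R by rewrite y_blend.
split.
- case=> t [[u i]|a]; last by rewrite yE; case: eqP; [right|left].
  rewrite ffunE /= sum_indicator point; case: eqP; by [right|left].
- move=> t; split.
  + under eq_bigr do rewrite wpE eq_sym -[_%:R]mul1r.
    by rewrite sum_indicator big_pred1_eq.
  + under eq_bigr do rewrite wqE eq_sym -[_%:R]mul1r.
    by rewrite sum_indicator big_pred1_eq.
- rewrite /some_arc (bigD1 s) //= sum_arcs (bigD1 b) //= yE fs eqxx -addrA lerDl.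
  rewrite addr_ge0 ?sumr_ge0 // => [a|t] _; first by rewrite yE.
  by rewrite sum_arcs sumr_ge0 // => a _; rewrite yE.
- move=> t i j ij; have := yE t (exist _ (i, j) ij).
  rewrite -y_pq_arc /= => ->; rewrite wpE wqE.
  by case: eqP => [<-|_] /=; rewrite ?eqxx.
Qed.

(** * Making the choice of an arc certain *)

(** Under the product of the laws [mu t], every schedule of positive
    probability chooses an arc at time [s], hence is a binary point. *)
Lemma blend_sure_arc (mu : 'I_T -> placement -> R) (s : 'I_T) :
  p != q -> (forall t, law (mu t)) -> (forall ij, mu s (inr ij) = 0) ->
  Ple R H T p q (blend mu).
Proof.
move=> pq muP mu_s.
have mu1 t : \sum_k mu t k = 1 by case: (muP t).
pose pr (f : {ffun 'I_T -> placement}) := \prod_t mu t (f t).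
have -> : blend mu =
    \sum_f pr f *: blend (fun t k => (k == (f : {ffun _}) t)%:R).
  apply: blend_comb => t k.
  rewrite (sum_prod_marginal t (fun k' => (k == k')%:R) mu1).
  under eq_bigr do rewrite eq_sym.
  by rewrite sum_indicator big_pred1_eq.
apply: (convex_set_sum (M := vec)).
- exact: convex_set_smallest.
- by move=> f; apply: prodr_ge0 => t _; case: (muP t).
- have := bigA_distr_bigA mu; rewrite /pr => <-.
  by rewrite big1.
- move=> f pr_gt0; apply: sub_gen_smallest.
  case fs : (f s) => [b|ij]; first exact: blend_point_binary fs.
  by move: pr_gt0; rewrite /pr (bigD1 s) //= fs mu_s mul0r ltxx.
Qed.

(** An arc chosen once in expectation can be chosen surely: [blend mu] is the
    mixture over s, of weight [c s], of points whose law at time s is [mu s]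
    conditioned on choosing an arc.  The case s = t contributes
    [active t / sigma] to [mu t], so in the other cases the law at t must be
    proportional to the difference [rest t].  This is nonnegative by
    the hypothesis, sigma >= 1. *)
Lemma blend_expected_arc (mu : 'I_T -> placement -> R) :
  p != q -> (forall t, law (mu t)) -> 1 <= \sum_t \sum_a mu t (inl a) ->
  Ple R H T p q (blend mu).
Proof.
move=> pq muP; set sigma := \sum_t _ => sigma_ge1.
pose Y t := \sum_a mu t (inl a).
pose active t k := if k is inl _ then mu t k else 0.
have mu0 t k : 0 <= mu t k by case: (muP t).
have Y0 t : 0 <= Y t by apply: sumr_ge0.
have sum_active t : \sum_k active t k = Y t.
  by rewrite big_sumType /= [X in _ + X]big1 ?addr0.
have active0 t k : 0 <= active t k by rewrite /active; case: k.
have sigma_gt0 : 0 < sigma by apply: lt_le_trans sigma_ge1.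
have sigma_neq0 : sigma != 0 by rewrite gt_eqF.
pose c t := Y t / sigma.
have c0 t : 0 <= c t by rewrite divr_ge0 // ltW.
have c1 : \sum_t c t = 1 by rewrite -mulr_suml divff.
pose rest t k := mu t k - active t k / sigma.
have rest0 t k : 0 <= rest t k.
  rewrite subr_ge0 ler_pdivrMr //.
  have le_active : active t k <= mu t k by rewrite /active; case: k.
  by apply: le_trans le_active _; rewrite ler_peMr.
have sum_rest t : \sum_k rest t k = 1 - c t.
  rewrite big_split /= sumrN -mulr_suml sum_active; congr (_ - _).
  by case: (muP t).
pose nu s t k := if s == t then active t k / Y t else rest t k / (1 - c t).
have -> : blend mu = \sum_s c s *: blend (nu s).
  apply: blend_comb => t k.
  rewrite (bigD1 t) //= {1}/nu eqxx.
  under eq_bigr => s /negPf st do rewrite /nu st.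
  rewrite -mulr_suml.
  have -> : \sum_(s | s != t) c s = 1 - c t.
    by apply/eqP; rewrite eq_sym subr_eq addrC -c1 (bigD1 t).
  (* If Y t = 0, the arc part of mu t is itself zero. *)
  have -> : c t * (active t k / Y t) = active t k / sigma.
    have [Yt0|Yt_neq0] := eqVneq (Y t) 0; last by rewrite /c; field; apply/andP.
    have /psumr_eq0P : \sum_k active t k = 0 by rewrite sum_active.
    by move=> -> //; rewrite !mul0r mulr0.
  (* If c t = 1, the total of the nonnegative weights rest t is zero. *)
  have -> : (1 - c t) * (rest t k / (1 - c t)) = rest t k.
    have [ct0|ct_neq0] := eqVneq (1 - c t) 0; last by rewrite mulrC divfK.
    have /psumr_eq0P : \sum_k rest t k = 0 by rewrite sum_rest.
    by move=> -> //; rewrite !mul0r mulr0.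
  by rewrite /rest addrC subrK.
apply: (convex_set_sum (M := vec)) => //; first exact: convex_set_smallest.
move=> s cs_gt0; apply: (@blend_sure_arc _ s) => //; last first.
  by move=> ij; rewrite /nu eqxx /active mul0r.
have Ys_neq0 : Y s != 0.
  by apply: contraTneq cs_gt0 => Ys0; rewrite /c Ys0 mul0r ltxx.
move=> t; rewrite /nu; have [<-|st] := eqVneq s t.
  by split=> [k|]; rewrite ?divr_ge0 // -mulr_suml sum_active divff.
(* The times s and t are distinct, and c s > 0 is part of the total 1. *)
have ct_lt1 : 0 < 1 - c t.
  rewrite subr_gt0 -c1 (bigD1 t) //= ltrDl (bigD1 s) //=.
  by rewrite ltr_pwDl // sumr_ge0.
split=> [k|]; first by rewrite divr_ge0 // ltW.
by rewrite -mulr_suml sum_rest divff // gt_eqF.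
Qed.

(** The residues [a] and [b] left at each vertex by the arcs are nonnegative by
    the neighbor inequalities, and both have mass 1 - Y; their product coupling
    is the law of the placements that choose no arc. *)
Lemma neighbor_polytope_blend x :
  p != q -> neighbor_polytope R H T p q x ->
  exists2 mu, forall t, law (mu t) & x = blend mu.
Proof.
move=> pq [x01 x1 _ xN].
pose out t i := \sum_(a : arc | (val a).1 == i) x (t, inr a).
pose into t i := \sum_(a : arc | (val a).2 == i) x (t, inr a).
pose Y t := \sum_(a : arc) x (t, inr a).
pose a t i := w_p x t i - out t i; pose b t j := w_q x t j - into t j.
have a0 t i : 0 <= a t i.
  by rewrite subr_ge0 /out -sum_out_arcs; case: (xN t i).
have b0 t i : 0 <= b t i.
  by rewrite subr_ge0 /into -sum_in_arcs; case: (xN t i).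
have sum_a t : \sum_i a t i = 1 - Y t.
  rewrite big_split /= sumrN; have [-> _] := x1 t; congr (_ - _).
  by rewrite /Y (partition_big (fun e : arc => (val e).1) xpredT).
have sum_b t : \sum_j b t j = 1 - Y t.
  rewrite big_split /= sumrN; have [_ ->] := x1 t; congr (_ - _).
  by rewrite /Y (partition_big (fun e : arc => (val e).2) xpredT).
have s0 t : 0 <= 1 - Y t by rewrite -sum_a sumr_ge0.
pose mu t (k : placement) := match k with
  | inl e => x (t, inr e)
  | inr ij => a t ij.1 * b t ij.2 / (1 - Y t)
  end.
have marg_a t := independent_coupling (a0 t) (sum_a t) (sum_b t).
have marg_b t := independent_coupling (b0 t) (sum_b t) (sum_a t).
have wpE t i : \sum_(k | (ends k).1 == i) mu t k = w_p x t i.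
  rewrite big_sumType /= -[w_p x t i](subrKC (out t i)) -/(a t i); congr (_ + _).
  rewrite -(marg_a t i) [LHS](reindex_onto (fun j => (i, j)) snd) /=; last first.
    by case=> i' j /= /eqP ->.
  by apply: eq_bigl => j; rewrite !eqxx.
have wqE t i : \sum_(k | (ends k).2 == i) mu t k = w_q x t i.
  rewrite big_sumType /= -[w_q x t i](subrKC (into t i)) -/(b t i); congr (_ + _).
  rewrite -(marg_b t i) [LHS](reindex_onto (fun j => (j, i)) fst) /=; last first.
    by case=> i' j /= /eqP ->.
  by apply: eq_big => [j|j _]; rewrite ?eqxx // [b t i * _]mulrC.
exists mu.
- move=> t; split.
    by case=> [e|ij] /=; [case/andP: (x01 (t, inr e))|rewrite divr_ge0 ?mulr_ge0].
  rewrite (partition_big (fun k => (ends k).1) xpredT) //=.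
  under eq_bigr do rewrite wpE.
  by case: (x1 t).
- apply/ffunP => -[t [[u i]|e]]; last by rewrite y_blend.
  case: u => u pqu; have /set2P[up|uq] := pqu; subst u.
  + rewrite (bool_irrelevance pqu (set21 p q)).
    by rewrite -/(w_p x t i) -/(w_p (blend mu) t i) w_p_blend wpE.
  + rewrite (bool_irrelevance pqu (set22 p q)).
    by rewrite -/(w_q x t i) -/(w_q (blend mu) t i) w_q_blend // wqE.
Qed.

End HullOfBinaryPoints.

Theorem corollary4p1 (R : realType) (V Q : finType)
    (H : sgraph V) (A : sgraph Q) (hVQ : #|V| = #|Q|)
    (T : nat) (hT : (1 <= T)%N) (p q : Q) (hpq : A p q) :
  Ple R H T p q = neighbor_polytope R H T p q.
Proof.
have pq : p != q by apply: contraTneq hpq => ->; rewrite adj_irr.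
apply/seteqP; split.
  apply: smallest_sub; [exact: convex_neighbor_polytope|exact: binary_points_sub].
move=> x xP; have [mu muP xE] := neighbor_polytope_blend pq xP.
rewrite xE; apply: blend_expected_arc => //.
have [_ _ + _] := xP; rewrite /some_arc xE; congr (_ <= _)%R.
by apply: eq_bigr => t _; rewrite sum_arcs; apply: eq_bigr => a _; rewrite y_blend.
Qed.
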